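(* Let $X=(X,\phi)$ be a discrete semi-flow whose underlying topological space $X$ is a $T_1$-space. Then $P(X)=L(X^{\mathbf r})$.
   Context: $\mathbb{N}=\{0,1,2,\dots\}$. A discrete semi-flow on a topological space $X$ is a continuous map $\phi\colon\mathbb{N}\times X\to X$ ($\mathbb{N}$ discrete) with $\phi(0,x)=x$ and $\phi(n,\phi(m,x))=\phi(n+m,x)$; write $\phi^n(x)=n\cdot x=\phi(n,x)$. A point $x$ is periodic if $n\cdot x=x$ for some $n\in\mathbb{N}$, $n\neq 0$; $P(X)$ is the set of periodic points. The right-absorbing externology $\varepsilon^{\mathbf r}(X)$ is the family of all open $E\subset X$ such that for every $x\in X$ there is $n\in\mathbb{N}$ with $\phi^m(x)\in E$ for all $m\ge n$. $X^{\mathbf r}$ denotes $(X,\phi,\varepsilon^{\mathbf r}(X))$, and its limit space is $L(X^{\mathbf r})=\bigcap_{E\in\varepsilon^{\mathbf r}(X)}E$. *)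

(* Defs.v *)
From mathcomp Require Import all_boot all_order all_algebra.
From mathcomp Require Import all_classical all_reals all_analysis.

Set Implicit Arguments.
Unset Strict Implicit.
Unset Printing Implicit Defensive.

Local Open Scope classical_set_scope.

(* [continuous] refers to the product topology on [nat * X], where the
   library's topology on [nat] is the discrete one. *)
Record semi_flow (X : topologicalType) := SemiFlow {
  flow :> nat * X -> X;
  flow_continuous : continuous flow;
  flow0 : forall x, flow (0%N, x) = x;
  flowD : forall n m x, flow (n, flow (m, x)) = flow ((n + m)%N, x)
}.

Definition periodic (X : topologicalType) (phi : semi_flow X) (x : X) : Prop :=
  exists n : nat, n <> 0%N /\ phi (n, x) = x.

Definition periodic_points (X : topologicalType) (phi : semi_flow X) : set X :=
  [set x | periodic phi x].

Definition right_absorbing (X : topologicalType) (phi : semi_flow X) :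
    set (set X) :=
  [set E | open E /\
    forall x : X, exists n : nat, forall m : nat, (n <= m)%N -> E (phi (m, x))].

(* The limit space of an exterior space depends on its externology only, so it
   is defined for a family of subsets; it is a subset of the carrier. *)
Definition limit_space (X : Type) (ext : set (set X)) : set X :=
  \bigcap_(E in ext) E.

(* Main.v *)
Require Import Defs.
From mathcomp Require Import all_boot all_order all_algebra.
From mathcomp Require Import all_classical all_reals all_analysis.

(** A periodic point returns to itself at arbitrarily late times, so every set
    that eventually absorbs its trajectory contains it.  Conversely, if [x] is
    not periodic, no trajectory visits [x] twice, since the time between two
    visits would be a period of [x].  Hence every trajectory eventually stays in
    the complement of [x]; that complement is open because points are closed
    in a T1 space, so it is a right-absorbing set that misses [x]. *)

Local Open Scope classical_set_scope.

Lemma flow_mul_period (X : topologicalType) (phi : semi_flow X) (n : nat)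
    (x : X) (k : nat) : phi (n, x) = x -> phi ((k * n)%N, x) = x.
Proof.
move=> nx; elim: k => [|k IHk]; first by rewrite mul0n flow0.
by rewrite mulSn -flowD IHk.
Qed.

Lemma flow_visits_twice_periodic (X : topologicalType) (phi : semi_flow X)
    (x y : X) (m m' : nat) :
  (m < m')%N -> phi (m, y) = x -> phi (m', y) = x -> periodic_points phi x.
Proof.
move=> lt_mm' my m'y; exists (m' - m)%N; split.
  by apply/eqP; rewrite -lt0n subn_gt0.
by rewrite -{1}my flowD subnK // ltnW.
Qed.

(** A trajectory visits a non-periodic point at most once, so it avoids that
    point from some time on. *)
Lemma right_absorbing_setC1 (X : topologicalType) (phi : semi_flow X) (x : X) :
  accessible_space X -> ~ periodic_points phi x -> right_absorbing phi (~` [set x]).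
Proof.
move=> T1 nper; split.
  by apply: closed_openC; exact: accessible_closed_set1.
move=> y; have [[m my]|never] := pselect (exists m, phi (m, y) = x).
  exists m.+1 => m' lt_mm' /= m'y; apply: nper.
  exact: (@flow_visits_twice_periodic X phi x y m m').
by exists 0%N => m _ /= my; apply: never; exists m.
Qed.

Theorem theorem7p1 (X : topologicalType) (phi : semi_flow X)
    (hT1 : accessible_space X) :
  periodic_points phi = limit_space (right_absorbing phi).
Proof.
apply/seteqP; split => x.
  move=> [n [/eqP n0 nx]] E [_ /(_ x)[N absE]].
  (* [N * n] is a multiple of the period that is at least [N], as [0 < n]. *)
  rewrite -(@flow_mul_period X phi n x N nx); apply: absE.
  by rewrite leq_pmulr // lt0n.
move=> Lx; apply: contrapT => nper.
exact: (Lx _ (@right_absorbing_setC1 X phi x hT1 nper)).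
Qed.
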